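(* Let $(X_t)_{t\in\mathbb{Z}}$ be a centered strictly stationary process with finite second moments satisfying $X_t-\phi X_{t-1}=Z_t$ for every $t\in\mathbb{Z}$, where $\phi=e^{-H}$ for some $H>0$ and $(Z_t)_{t\in\mathbb{Z}}$ is a strictly stationary process. Let $\gamma(n)=\operatorname{cov}(X_t,X_{t+n})$, $r(n)=\operatorname{cov}(Z_t,Z_{t+n})$, and let $N\in\mathbb{N}$ be fixed. Let $\hat\gamma_T(N+1)$, $\hat\gamma_T(N-1)$ be estimators of $\gamma(N+1)$, $\gamma(N-1)$ based on observations $(X_1,\ldots,X_T)$, and let $\hat\phi_T$ be the truncation to $[0,1]$ of $$-\frac{r(N)}{\hat\gamma_T(N+1)+\hat\gamma_T(N-1)}\,\mathbf{1}_{\{\hat\gamma_T(N+1)+\hat\gamma_T(N-1)\neq0\}}.$$ Assume that $\gamma(N)=0$ and $r(N)\neq0$. Set $\boldsymbol{\gamma}=[\gamma(N+1),\gamma(N-1)]^\top$ and $\hat{\boldsymbol{\gamma}}_T=[\hat\gamma_T(N+1),\hat\gamma_T(N-1)]^\top$. If $$l(T)(\hat{\boldsymbol{\gamma}}_T-\boldsymbol{\gamma})\xrightarrow{\text{law}}\mathcal{N}(\mathbf{0},\Sigma)\quad\text{as }T\to\infty$$ for some covariance matrix $\Sigma$ and some rate function $l(T)$, then $$l(T)(\hat\phi_T-\phi)\xrightarrow{\text{law}}\mathcal{N}\bigl(0,\nabla f(\boldsymbol{\gamma})^\top\Sigma\,\nabla f(\boldsymbol{\gamma})\bigr)\quad\text{as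 }T\to\infty,$$ where $$\nabla f(\boldsymbol{\gamma})=-\frac{r(N)}{(\gamma(N+1)+\gamma(N-1))^2}\begin{bmatrix}1\\1\end{bmatrix}.$$
   Context: All processes are real-valued. A process $X=(X_t)_{t\in\mathbb{Z}}$ is strictly stationary if $(X_{t+n_1},\ldots,X_{t+n_k})$ and $(X_{n_1},\ldots,X_{n_k})$ have the same law for all $k\in\mathbb{N}$ and $t,n_1,\ldots,n_k\in\mathbb{Z}$. Centered means $\mathbb{E}(X_t)=0$ for every $t$. The truncation to $[0,1]$ of a real number $y$ is $y$ if $y\in[0,1]$, $0$ if $y<0$, and $1$ if $y>1$. The expression with the indicator is $0$ when the indicator is $0$. The estimators $\hat\gamma_T(n)$ are arbitrary real-valued random variables (functions of the observations); no specific form is assumed. A rate function is a positive function $l$ with $l(T)\to\infty$ as $T\to\infty$. Normal distributions may be degenerate ($\Sigma$ is symmetric positive semidefinite; $\mathcal{N}(0,0)$ is the point mass at $0$). *)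

(* Defs.v *)
From mathcomp Require Import all_boot all_order all_algebra.
From mathcomp Require Import all_classical all_reals all_analysis.

Set Implicit Arguments.
Unset Strict Implicit.
Unset Printing Implicit Defensive.

Import Order.TTheory GRing.Theory Num.Theory.
Import numFieldNormedType.Exports.

Local Open Scope classical_set_scope.
Local Open Scope ring_scope.

(* Equality of finite-dimensional laws is equality on the product sigma-algebra
   of the tuple type k.-tuple R. *)
Definition strictly_stationary d (Om : measurableType d) (R : realType)
    (P : probability Om R) (X : int -> {RV P >-> R}) : Prop :=
  forall (k : nat) (n : 'I_k -> int) (t : int) (A : set (k.-tuple R)),
    measurable A ->
    pushforward P (fun w => [tuple X (t + n i) w | i < k]) A =
    pushforward P (fun w => [tuple X (n i) w | i < k]) A.

(* cov(X_t, X_{t+n}), taken at t = 0; it does not depend on t when X is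
   strictly stationary. *)
Definition autocov d (Om : measurableType d) (R : realType)
    (P : probability Om R) (X : int -> {RV P >-> R}) (n : int) : R :=
  fine (covariance P (X 0) (X n)).

Definition observations d (Om : measurableType d) (R : realType)
    (P : probability Om R) (X : int -> {RV P >-> R}) (T : nat) (w : Om) :
    T.-tuple R :=
  [tuple X i.+1%:Z w | i < T].

Definition trunc01 (R : realType) (y : R) : R :=
  if y < 0 then 0 else if 1 < y then 1 else y.

Definition vec2 (R : realType) (a b : R) : 'cV[R]_2 :=
  \col_i (if i == 0 then a else b).

Definition qform (R : realType) (n : nat) (S : 'M[R]_n) (u : 'cV[R]_n) : R :=
  (u^T *m S *m u) 0 0.

Definition covariance_matrix (R : realType) (n : nat) (S : 'M[R]_n) : Prop :=
  S^T = S /\ forall u : 'cV[R]_n, 0 <= qform S u.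

(* N(m, v) with v the variance. [normal_prob] takes the standard deviation and
   is the uniform law on [0, 1] when that is 0, hence the separate Dirac case.
   Only meaningful for 0 <= v. *)
Definition normal_law (R : realType) (m v : R) :
    probability (measurableTypeR R) R :=
  if v == 0 then (@dirac _ (measurableTypeR R) m R : probability _ R)
  else (normal_prob m (Num.sqrt v) : probability _ R).

(* G ~ N(m, S): every linear combination u^T G is N(u^T m, u^T S u). *)
Definition normal_vector d (Om : measurableType d) (R : realType)
    (P : probability Om R) (n : nat) (G : Om -> 'cV[R]_n)
    (m : 'cV[R]_n) (S : 'M[R]_n) : Prop :=
  forall u : 'cV[R]_n,
    let uG := fun w => (u^T *m G w) 0 0 in
    measurable_fun setT uG /\
    forall A : set R, measurable A ->
      pushforward P uG A = normal_law ((u^T *m m) 0 0) (qform S u) A.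

(* Convergence in law of Y_T to a random element G, possibly defined on another
   probability space, tested against bounded continuous functions. A limit law
   mu is encoded as G := idfun on the probability space (E, mu). *)
Definition cvg_in_law d (Om : measurableType d) (R : realType)
    (P : probability Om R) (E : topologicalType) (Y : nat -> Om -> E)
    d' (Om' : measurableType d') (P' : probability Om' R) (G : Om' -> E) : Prop :=
  forall f : E -> R, continuous f -> bounded_fun f ->
    ('E_P[f \o Y T] @[T --> \oo] --> 'E_P'[f \o G])%E.

(* Main.v *)
Require Import Defs.
From mathcomp Require Import all_boot all_order all_algebra.
From mathcomp Require Import all_classical all_reals all_analysis.
From mathcomp Require Import measurable_realfun ring lra.

(* Expanding cov(X_0 - phi X_{-1}, X_n - phi X_{n-1}) gives
   r(n) = (1 + phi^2) gamma(n) - phi (gamma(n+1) + gamma(n-1)), so gamma(N) = 0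
   and r(N) != 0 force s := gamma(N+1) + gamma(N-1) != 0 and phi = - r(N) / s.
   Hence the estimator is F(s_T), where s_T estimates s and
   F(y) = trunc01 (- r(N) / y); as 0 < phi < 1 the truncation is inactive near s
   and F is differentiable there, so the delta method applies. The delta method
   itself is a continuous mapping theorem for the varying maps
   x |-> l_T (F(s + x / l_T) - F(s)), which converge to x |-> F'(s) x locally
   uniformly, the tails being controlled by convergence in law. *)

Set Implicit Arguments.
Unset Strict Implicit.
Unset Printing Implicit Defensive.

Import Order.TTheory GRing.Theory Num.Theory.
Import numFieldNormedType.Exports.

Local Open Scope classical_set_scope.
Local Open Scope ring_scope.

(** * Bounded functions, expectations and tail cutoffs *)

Lemma bounded_fun_normr_le (T : Type) (R : realType) (f : T -> R) :
  bounded_fun f -> exists2 M : R, 0 < M & forall x, `|f x| <= M.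
Proof.
(* [bounded_fun] provides the bound for all large [M]; choosing [M] near infinity also makes it
   positive. *)
move=> bf; near (pinfty_nbhs R) => M; exists M => // x.
suff H : forall x, setT x -> `|f x| <= M by exact: H.
by near: M.
Unshelve. all: by end_near. Qed.

Lemma normr_le_bounded_fun (T : Type) (R : realType) (f : T -> R) (M : R) :
  (forall x, `|f x| <= M) -> bounded_fun f.
Proof.
move=> fM; exists M; split; first exact: num_real.
by move=> N MN x _ /=; rewrite (le_trans (fM x))// ltW.
Qed.

Lemma bounded_integrable (d : measure_display) (Om : measurableType d)
    (R : realType) (P : probability Om R) (f : Om -> R) :
  measurable_fun setT f -> bounded_fun f -> P.-integrable setT (EFin \o f).
Proof.
move=> mf bf; apply: measurable_bounded_integrable => //.
exact: (le_lt_trans (probability_le1 P measurableT) (ltry 1)).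
Qed.

Lemma expectation_Rintegral (d : measure_display) (Om : measurableType d)
    (R : realType) (P : probability Om R) (f : Om -> R) :
  P.-integrable setT (EFin \o f) ->
  ('E_P[f] = (\int[P]_w f w)%R%:E)%E.
Proof.
by move=> fi; rewrite unlock /Rintegral fineK// integrable_fin_num.
Qed.

(* A bounded continuous majorant of the indicator of [n.+1 <= `|x|], so that
   convergence in law controls the tails of the whole sequence. *)
Definition tailcut (R : realType) (n : nat) (x : R) : R :=
  Num.min 1 (Num.max 0 (`|x| - n%:R)).

Section tailcut.
Context (R : realType).
Implicit Types (n : nat) (x : R).

Lemma tailcut_ge0 n x : 0 <= tailcut n x.
Proof. by rewrite /tailcut le_min ler01/= le_max lexx. Qed.

Lemma tailcut_le1 n x : tailcut n x <= 1.
Proof. by rewrite /tailcut ge_min lexx. Qed.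

Lemma normr_tailcut n x : `|tailcut n x| <= 1.
Proof. by rewrite ger0_norm ?tailcut_ge0// tailcut_le1. Qed.

Lemma tailcut_eq1 n x : n.+1%:R <= `|x| -> tailcut n x = 1.
Proof.
move=> nx; have : 1 <= `|x| - n%:R by move: nx; rewrite -natr1; lra.
by move=> h; apply/min_idPl; rewrite le_max h orbT.
Qed.

Lemma tailcut_eq0 n x : `|x| <= n%:R -> tailcut n x = 0.
Proof.
by move=> nx; rewrite /tailcut (max_idPl _) ?subr_le0//; apply/min_idPr.
Qed.

Lemma continuous_tailcut n : continuous (@tailcut R n).
Proof.
move=> x.
have h1 : {for x, continuous (fun y : R => `|y| - n%:R : R^o)}.
  by apply: cvgB; [exact: norm_continuous|exact: cvg_cst].
have h2 := @continuous_max R R (cst 0) _ x (cvg_cst 0) h1.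
have h3 : {for x, continuous
    (cst 1 \min (cst 0 \max (fun y : R => `|y| - n%:R : R^o)))}.
  by apply: continuous_min; [exact: cvg_cst|exact: h2].
exact: h3.
Qed.

Lemma measurable_tailcut n : measurable_fun setT (@tailcut R n).
Proof. by apply: continuous_measurable_fun; exact: continuous_tailcut. Qed.

Lemma cvg_tailcut x : tailcut n x @[n --> \oo] --> (0 : R).
Proof.
apply: cvg_near_cst; near=> n; apply: tailcut_eq0.
by near: n; exact: nbhs_infty_ger.
Unshelve. all: by end_near. Qed.

(** Dominated convergence with bound 1: at a fixed [w] the cutoff vanishes once [n] exceeds [|U w|].
    It lets a cutoff level be chosen from the limit variable alone. *)
Lemma cvg_expectation_tailcut (d : measure_display) (Om : measurableType d)
    (P : probability Om R) (U : Om -> R) : measurable_fun setT U ->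
  \int[P]_w tailcut n (U w) @[n --> \oo] --> (0 : R).
Proof.
move=> mU.
have [] := @dominated_convergence _ _ _ P setT measurableT
  (fun n w => (tailcut n (U w))%:E) (cst 0%E) (cst 1%E).
- move=> n; apply/measurable_EFinP.
  exact: (measurableT_comp (measurable_tailcut n)).
- exact: measurable_cst.
- by apply/aeW => w _; apply: cvg_EFin;
    [exact: nearW|exact: (cvg_tailcut (U w))].
- exact: finite_measure_integrable_cst.
- by apply/aeW => w n _; rewrite lee_fin normr_tailcut.
move=> _ _; rewrite integral0 => /fine_cvgP[_]; exact.
Qed.

End tailcut.

(** * Continuous mapping theorem with varying maps *)

(** Joint convergence along [filter_prod] makes [f \o g_ T] uniformly close to [f \o g] on compact
    sets for large [T]. Up to a tail error [g_ T] is thus replaced by [g], and [f \o g] is a bounded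
    continuous test function for [Y]. *)
Lemma cvg_in_law_extended_continuous (d : measure_display)
    (Om : measurableType d) (R : realType) (P : probability Om R)
    (d' : measure_display) (Om' : measurableType d') (P' : probability Om' R)
    (Y : nat -> Om -> R) (U : Om' -> R) (g_ : nat -> R -> R) (g : R -> R) :
  (forall T, measurable_fun setT (Y T)) -> measurable_fun setT U ->
  (forall T, measurable_fun setT (g_ T)) -> continuous g ->
  (forall x, g_ p.2 p.1 @[p --> filter_prod (nbhs x) \oo] --> g x) ->
  cvg_in_law P Y P' U ->
  cvg_in_law P (fun T w => g_ T (Y T w)) P' (g \o U).
Proof.
move=> mY mU mg_ cg cg_ YU f cf bf.
have [M M0 fM] := bounded_fun_normr_le bf.
have mf : measurable_fun setT f by exact: continuous_measurable_fun.
have mg : measurable_fun setT g by exact: continuous_measurable_fun.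
(* [B] is the intermediate term: limit map [g], but still the variable [Y T]. Its mean has the
   desired limit, so it remains to show that the means of [A] and [B] differ by a null sequence. *)
pose A T := f \o g_ T \o Y T; pose B T := f \o g \o Y T.
have mB T : measurable_fun setT (B T).
  by apply: measurableT_comp => //; exact: measurableT_comp.
have mA T : measurable_fun setT (A T).
  by apply: measurableT_comp => //; exact: measurableT_comp.
have iA T : P.-integrable setT (EFin \o A T).
  apply: bounded_integrable => //.
  by apply: (normr_le_bounded_fun (M := M)) => w; exact: fM.
have iB T : P.-integrable setT (EFin \o B T).
  apply: bounded_integrable => //.
  by apply: (normr_le_bounded_fun (M := M)) => w; exact: fM.
have iL : P'.-integrable setT (EFin \o (f \o g \o U)).
  apply: bounded_integrable.
    by apply: measurableT_comp => //; exact: measurableT_comp.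
  by apply: (normr_le_bounded_fun (M := M)) => w; apply: fM.
have it n T : P.-integrable setT (EFin \o (@tailcut R n \o Y T)).
  apply: bounded_integrable.
    exact: (measurableT_comp (@measurable_tailcut R n)).
  by apply: (normr_le_bounded_fun (M := 1)) => w; exact: normr_tailcut.
have itU n : P'.-integrable setT (EFin \o (@tailcut R n \o U)).
  apply: bounded_integrable.
    exact: (measurableT_comp (@measurable_tailcut R n)).
  by apply: (normr_le_bounded_fun (M := 1)) => w; exact: normr_tailcut.
have cfg : continuous (f \o g).
  by move=> x; apply: continuous_comp; [exact: cg|exact: cf].
have cB : \int[P]_w B T w @[T --> \oo] --> \int[P']_w (f \o g \o U) w.
  have : bounded_fun (f \o g) by apply: (normr_le_bounded_fun (M := M)) => x; exact: fM.
  move=> /(YU _ cfg).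
  rewrite (expectation_Rintegral iL).
  under eq_fun do rewrite (expectation_Rintegral (iB _)).
  by move=> /fine_cvgP[_].
have ct n : \int[P]_w tailcut n (Y T w) @[T --> \oo] --> \int[P']_w tailcut n (U w).
  have : bounded_fun (@tailcut R n).
    by apply: (normr_le_bounded_fun (M := 1)); exact: normr_tailcut.
  move=> /(YU _ (@continuous_tailcut R n)).
  rewrite (expectation_Rintegral (itU n)).
  under eq_fun do rewrite (expectation_Rintegral (it n _)).
  by move=> /fine_cvgP[_].
rewrite (expectation_Rintegral iL).
under eq_fun do rewrite (expectation_Rintegral (iA _)).
apply: cvg_EFin; first exact: nearW.
have -> : fine \o (fun T => (\int[P]_w A T w)%:E) =
  (fun T => (\int[P]_w A T w - \int[P]_w B T w) + \int[P]_w B T w).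
  by apply/funext => T /=; rewrite subrK.
rewrite -[X in _ --> X]add0r; apply: cvgD => //.
apply/cvgr0Pnorm_le => e e0.
(* The compact part and the tail each receive [e / 2]; for the tail, [2 * M] times [e / (4 * M)] is
   [e / 2]. *)
have e4 : 0 < e / 2 by rewrite divr_gt0.
have e2M : 0 < e / (4 * M) by rewrite divr_gt0// mulr_gt0.
have [n Un] : exists n, \int[P']_w tailcut n (U w) < e / (4 * M).
  have /cvgr0Pnorm_lt/(_ _ e2M) := cvg_expectation_tailcut P' mU.
  by move=> [n _ /(_ n (leqnn n)) h]; exists n; rewrite (le_lt_trans (ler_norm _)).
(* Compactness turns the local estimates into a single threshold in [T] for the whole segment. The
   radius is [n.+1] because [tailcut n] reaches 1 only there. *)
have nK : \forall T \near \oo, `[- n.+1%:R, n.+1%:R]%classic `<=`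
    (fun x => `|f (g_ T x) - f (g x)| <= e / 2).
  apply: (iffLR (compact_near_coveringP _) (@segment_compact R _ _)) => x _.
  have FF : Filter (filter_prod (nbhs (x : R)) (\oo : set_system nat)).
    exact: filter_prod_filter.
  have h1 : f (g_ p.2 p.1) @[p --> filter_prod (nbhs x) \oo] --> f (g x).
    by apply: (cvg_comp _ f (cg_ x)); exact: cf.
  have h2 : f (g p.1) @[p --> filter_prod (nbhs x) \oo] --> f (g x).
    apply: (@cvg_comp _ _ _ fst (f \o g) _ _ _ cvg_fst).
    exact: cfg.
  have := @cvgB R R _ _ FF _ _ _ _ h1 h2.
  rewrite subrr => /cvgr0Pnorm_le/(_ _ e4).
  exact.
near=> T.
(* Near infinity the error is bounded by [e / 2] on the compact [-n-1, n+1], by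
   [2 * M] outside, and there the cutoff is 1. *)
have key w : `|A T w - B T w| <= e / 2 + 2 * M * tailcut n (Y T w).
  have [Yn|Yn] := leP `|Y T w| n.+1%:R.
    rewrite (@le_trans _ _ (e / 2))//; last first.
      by rewrite lerDl mulr_ge0 ?tailcut_ge0// mulr_ge0// ltW.
    have : (`[- n.+1%:R, n.+1%:R]%classic `<=`
      (fun x => `|f (g_ T x) - f (g x)| <= e / 2)) by near: T.
    by apply; rewrite /= in_itv/= -ler_norml.
  rewrite (tailcut_eq1 (ltW Yn)) mulr1 /A /B /= (le_trans (ler_normB _ _))//.
  by have := fM (g_ T (Y T w)); have := fM (g (Y T w)); lra.
have iAB : P.-integrable setT (EFin \o (fun w => A T w - B T w)).
  exact: (integrableB measurableT (iA T) (iB T)).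
have i2 : P.-integrable setT (EFin \o (fun w => 2 * M * tailcut n (Y T w))).
  by apply: (integrableZl measurableT (2 * M) (it n T)).
have i1 : P.-integrable setT (EFin \o (fun w => e / 2)).
  by apply: bounded_integrable => //; apply: (normr_le_bounded_fun (M := `|e / 2|)).
rewrite -RintegralB//.
apply: (le_trans (le_normr_Rintegral _ _)) => //.
apply: (@le_trans _ _ (\int[P]_w (e / 2 + 2 * M * tailcut n (Y T w)))).
  apply: le_Rintegral => //.
  - exact: integrable_norm.
  - exact: (integrableD measurableT i1 i2).
rewrite RintegralD// Rintegral_cst//.
have -> : fine (P setT) = 1 by rewrite probability_setT.
rewrite mulr1.
rewrite (RintegralZl _ _ (it n T))//.
(* The limit of these means lies strictly below the bound, by the choice of [n], so large [T]
   inherit it. *)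
have : \int[P]_w tailcut n (Y T w) <= e / (4 * M).
  by near: T; exact: (cvgr_le _ (ct n) _ Un).
rewrite ler_pdivlMr ?mulr_gt0//; nra.
Unshelve. all: by end_near. Qed.

(** * Measurability and differentiability of the plug-in map *)

Lemma measurable_trunc01 (R : realType) : measurable_fun setT (@trunc01 R).
Proof.
apply: measurable_fun_ifT; first exact: measurable_fun_ltr.
  exact: measurable_cst.
apply: measurable_fun_ifT; first exact: measurable_fun_ltr.
  exact: measurable_cst.
exact: measurable_id.
Qed.

Lemma trunc01_id (R : realType) (y : R) : 0 <= y <= 1 -> trunc01 y = y.
Proof. by move=> /andP[y0 y1]; rewrite /trunc01 !ltNge y0 y1. Qed.

Lemma measurable_plugin (R : realType) (r : R) :
  measurable_fun setT (fun y : R => trunc01 (if y != 0 then - (r / y) else 0)).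
Proof.
apply: (measurableT_comp (@measurable_trunc01 R)).
apply: measurable_fun_if => //.
- apply: measurable_neg.
  exact: measurable_fun_eqr.
- rewrite setTI.
  apply: open_continuous_measurable_fun; first exact: open_neq.
  move=> y /[!inE]/= y0; apply: cvgN; apply: cvgM; first exact: cvg_cst.
  exact: inv_continuous.
Qed.

(** Since [- (r / s)] lies strictly inside the unit interval, continuity keeps [- (r / y)] in it for
    [y] near [s], and [y] stays nonzero. Neither the truncation nor the indicator acts there, and
    the derivative is that of [- (r / y)]. *)
Lemma is_derive_plugin (R : realType) (r s : R) : s != 0 ->
  0 < - (r / s) < 1 ->
  is_derive s 1 (fun y : R => trunc01 (if y != 0 then - (r / y) else 0))
    (r / s ^+ 2).
Proof.
move=> s0 /andP[p0 p1].
have cF : {for s, continuous (fun y : R => - (r / y))}.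
  by apply: cvgN; apply: cvgM; [exact: cvg_cst|exact: inv_continuous].
apply: (@near_eq_is_derive _ _ _ (fun y : R => - (r / y))).
  near=> y.
  have y0 : y != 0 by near: y; apply: open_nbhs_nbhs; split; [exact: open_neq|exact: s0].
  rewrite y0 trunc01_id//; apply/andP; split; near: y.
    exact: (cvgr_ge _ cF).
  exact: (cvgr_le _ cF).
have -> : (fun y : R => - (r / y)) = - r \*: (fun y : R => y^-1).
  by apply/funext => y /=; rewrite /GRing.scale/= mulNr.
have -> : r / s ^+ 2 = - r *: (- s ^- 2 *: 1).
  by rewrite /GRing.scale/= mulr1 mulrNN.
apply: is_deriveZ; exact: is_deriveV.
Unshelve. all: by end_near. Qed.

(** * The delta method *)

Lemma delta_method (d : measure_display) (Om : measurableType d)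
    (R : realType) (P : probability Om R)
    (d' : measure_display) (Om' : measurableType d') (P' : probability Om' R)
    (Y : nat -> Om -> R) (U : Om' -> R) (l : nat -> R) (F : R -> R) (s c : R) :
  (forall T, measurable_fun setT (Y T)) -> measurable_fun setT U ->
  measurable_fun setT F -> is_derive s 1 F c ->
  (forall T, 0 < l T) -> l T @[T --> \oo] --> +oo ->
  cvg_in_law P (fun T w => l T * (Y T w - s)) P' U ->
  cvg_in_law P (fun T w => l T * (F (Y T w) - F s)) P' (fun w => c * U w).
Proof.
move=> mY mU mF dF l0 ly YU.
pose g_ T x := l T * (F (s + (l T)^-1 * x) - F s).
(* With [x = l T * (Y T w - s)] the point [s + x / l T] is [Y T w], so the rescaled error is [g_ T]
   applied to a sequence converging in law. *)
have -> : (fun T w => l T * (F (Y T w) - F s)) =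
    (fun T w => g_ T (l T * (Y T w - s))).
  apply/funext => T; apply/funext => w; rewrite /g_ mulrA mulVf ?gt_eqF//.
  by rewrite mul1r subrKC.
apply: (@cvg_in_law_extended_continuous _ _ _ _ _ _ _ _ U g_ ( *%R c)) => //.
- move=> n; apply: (@measurable_funM _ _ _ _ (cst (l n)) (fun w => Y n w - s)) => //.
  exact: (@measurable_funB _ _ _ _ (Y n) (cst s)).
- move=> n; apply: (@measurable_funM _ _ _ _ (cst (l n))
    (fun x => F (s + (l n)^-1 * x) - F s)) => //.
  apply: (@measurable_funB _ _ _ _ _ (cst (F s))) => //.
  apply: (measurableT_comp mF); apply: (@measurable_funD _ _ _ _ (cst s)) => //.
- exact: mulrl_continuous.
move=> x.
(* [l (F (s + x / l) - F s) = q (x / l) * x] with [q] continuous at 0. *)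
pose q h := if h == 0 then c else h^-1 * (F (s + h) - F s).
have cq : {for 0, continuous q}.
  (* On a punctured neighbourhood of 0, [q] is the difference quotient, so its continuity at 0 is
     the differentiability of [F] at [s]. *)
  apply/continuous_withinNx; rewrite /q eqxx.
  have [/cvg_ex[/= c' Fc'] Fc] := dF.
  have cc' : c' = c.
    by rewrite -Fc; apply/esym; apply: cvg_lim => //; exact: norm_hausdorff.
  move: Fc'; rewrite cc'; apply: cvg_trans; apply: near_eq_cvg.
  near=> h.
  have h0 : h != 0 by near: h; exact: nbhs_dnbhs_neq.
  by rewrite (negbTE h0) /GRing.scale/= mulr1 [s + h]addrC.
have FF : Filter (filter_prod (nbhs (x : R)) (\oo : set_system nat)).
  exact: filter_prod_filter.
have cx : p.1 @[p --> filter_prod (nbhs x) (\oo : set_system nat)] --> x.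
  exact: cvg_fst.
have cl : (l p.2)^-1 @[p --> filter_prod (nbhs x) (\oo : set_system nat)] --> (0 : R).
  apply: (@cvg_comp _ _ _ snd (fun T => (l T)^-1) _ _ _ cvg_snd).
  by apply/gtr0_cvgV0 => //; exact: nearW.
have clx : (l p.2)^-1 * p.1
    @[p --> filter_prod (nbhs x) (\oo : set_system nat)] --> (0 : R).
  by rewrite -[X in _ --> X](mul0r x); exact: (cvgM cl cx).
have cqx : q ((l p.2)^-1 * p.1)
    @[p --> filter_prod (nbhs x) (\oo : set_system nat)] --> c.
  have -> : c = q 0 by rewrite /q eqxx.
  exact: (cvg_comp _ q clx cq).
have -> : (fun p : R * nat => g_ p.2 p.1) =
    (fun p : R * nat => q ((l p.2)^-1 * p.1) * p.1).
  apply/funext => -[y T] /=; rewrite /q /g_.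
  (* At [y = 0] both sides vanish; otherwise the argument of [q] is nonzero, as [l T] is
     positive. *)
  have [->|y0] := eqVneq y 0; first by rewrite !mulr0 addr0 subrr mulr0.
  rewrite mulf_eq0 (negbTE y0) orbF invr_eq0 gt_eqF//.
  by rewrite invfM invrK; set D := F _ - F s; field.
exact: (cvgM cqx cx).
Unshelve. all: by end_near. Qed.

(** * Stationarity and the autocovariance identity *)

(** Both expectations are integrals against the same image measure. With one space this yields shift
    invariance of covariances; with two it identifies the limit law. *)
Lemma eq_law_expectation (R : realType) (d : measure_display)
    (E : measurableType d)
    (d1 d2 : measure_display) (Om1 : measurableType d1)
    (Om2 : measurableType d2) (P1 : probability Om1 R)
    (P2 : probability Om2 R) (S1 : Om1 -> E) (S2 : Om2 -> E) (g : E -> R) :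
  measurable_fun setT S1 -> measurable_fun setT S2 -> measurable_fun setT g ->
  P1.-integrable setT (EFin \o (g \o S1)) ->
  P2.-integrable setT (EFin \o (g \o S2)) ->
  (forall A, measurable A -> pushforward P1 S1 A = pushforward P2 S2 A) ->
  ('E_P1[g \o S1] = 'E_P2[g \o S2])%E.
Proof.
move=> mS1 mS2 mg i1 i2 S12; rewrite unlock.
have mEg : measurable_fun setT (EFin \o g) by exact/measurable_EFinP.
have -> : (\int[P1]_w ((g \o S1) w)%:E = \int[pushforward P1 S1]_y (g y)%:E)%E.
  by rewrite (integral_pushforward mS1 mEg i1)// preimage_setT.
have -> : (\int[P2]_w ((g \o S2) w)%:E = \int[pushforward P2 S2]_y (g y)%:E)%E.
  by rewrite (integral_pushforward mS2 mEg i2)// preimage_setT.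
by apply: eq_measure_integral => A mA _; exact: S12.
Qed.

Lemma covariance_centered (d : measure_display) (Om : measurableType d)
    (R : realType) (P : probability Om R) (X Y : Om -> R) :
  ('E_P[X] = 0)%E -> ('E_P[Y] = 0)%E -> covariance P X Y = ('E_P[X * Y])%E.
Proof.
move=> X0 Y0; rewrite [in LHS]unlock X0 Y0; congr (expectation P _).
by apply/funext => w; rewrite !fctE /= !subr0.
Qed.

Lemma measurable_mktuple (d d' : measure_display) (Om : measurableType d)
    (E : measurableType d') (k : nat) (f : 'I_k -> Om -> E) :
  (forall i, measurable_fun setT (f i)) ->
  measurable_fun setT (fun w => [tuple f i w | i < k]).
Proof.
move=> mf; apply/measurable_fun_tnthP => i.
by apply: (eq_measurable_fun (f i)) => // w _; rewrite /= tnth_mktuple.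
Qed.

(** For centered variables the covariance is the mean of a product, which depends only on the law of
    the pair. *)
Lemma strictly_stationary_covariance (d : measure_display)
    (Om : measurableType d) (R : realType) (P : probability Om R)
    (X : int -> {RV P >-> R}) (t a b : int) :
  strictly_stationary X -> (forall n, (X n : Om -> R) \in Lfun P 2%:E) ->
  (forall n, 'E_P[X n] = 0)%E ->
  covariance P (X (t + a)) (X (t + b)) = covariance P (X a) (X b).
Proof.
move=> sX X2 X0; rewrite !covariance_centered//.
pose n (i : 'I_2) := if i == 0 then a else b.
pose V m w := [tuple X (m + n i) w | i < 2].
have mV m : measurable_fun setT (V m).
  by apply: measurable_mktuple => i.
pose g (y : 2.-tuple R) := tnth y 0 * tnth y 1.
have gV m : g \o V m = (X (m + a) : Om -> R) * X (m + b).
  by apply/funext => w; rewrite /g /V /= !tnth_mktuple.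
have mg : measurable_fun setT g.
  by apply: measurable_funM; exact: measurable_tnth.
have iV m : P.-integrable setT (EFin \o (g \o V m)).
  by rewrite gV; exact/Lfun1_integrable/Lfun2_mul_Lfun1.
(* Writing [a] and [b] as [0 + a] and [0 + b] exhibits the right-hand side as the case [m = 0] of
   [V]. *)
rewrite -gV -[in RHS](add0r a) -[in RHS](add0r b) -gV.
apply: eq_law_expectation => // A mA.
by rewrite /V sX//; under [in RHS]eq_fun do under eq_mktuple do rewrite add0r.
Qed.

Lemma ae_eq_expectation (d : measure_display) (Om : measurableType d)
    (R : realType) (P : probability Om R) (f g : Om -> R) :
  measurable_fun setT f -> measurable_fun setT g ->
  {ae P, forall w, f w = g w} -> ('E_P[f] = 'E_P[g])%E.
Proof.
move=> mf mg fg; rewrite unlock.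
apply: ae_eq_integral => //; first exact/measurable_EFinP.
  exact/measurable_EFinP.
by apply: filterS fg => w -> _.
Qed.

(** This allows the autoregressive relation, which holds almost surely at each [t], to be
    substituted inside a covariance. *)
Lemma ae_eq_covariance (d : measure_display) (Om : measurableType d)
    (R : realType) (P : probability Om R) (f f' g g' : Om -> R) :
  measurable_fun setT f -> measurable_fun setT f' ->
  measurable_fun setT g -> measurable_fun setT g' ->
  {ae P, forall w, f w = f' w} -> {ae P, forall w, g w = g' w} ->
  covariance P f g = covariance P f' g'.
Proof.
move=> mf mf' mg mg' ff' gg'; rewrite unlock.
rewrite (ae_eq_expectation mf mf' ff') (ae_eq_expectation mg mg' gg').
apply: ae_eq_expectation.
- by apply: measurable_funM; apply: measurable_funB => //; exact: measurable_cst.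
- by apply: measurable_funM; apply: measurable_funB => //; exact: measurable_cst.
by move: ff' gg'; apply: filterS2 => w /= fw gw; rewrite !fctE /= fw gw.
Qed.

(** Bilinearity gives four covariances, and stationarity of [X] reduces each to its lag: [n] twice,
    with weights 1 and [phi ^+ 2], then [n + 1] and [n - 1], each with weight [- phi]. *)
Lemma autocov_ar1 (d : measure_display) (Om : measurableType d)
    (R : realType) (P : probability Om R) (X Z : int -> {RV P >-> R})
    (phi : R) (n : int) :
  strictly_stationary X -> (forall t, (X t : Om -> R) \in Lfun P 2%:E) ->
  (forall t, 'E_P[X t] = 0)%E ->
  (forall t, {ae P, forall w, X t w - phi * X (t - 1) w = Z t w}) ->
  autocov Z n = (1 + phi ^+ 2) * autocov X n
                - phi * (autocov X (n + 1) + autocov X (n - 1)).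
Proof.
move=> sX X2 X0 XZ.
pose W t : Om -> R := (X t : Om -> R) \- phi \o* X (t - 1).
have mW t : measurable_fun setT (W t).
  by apply: measurable_funB => //; exact: measurable_funM.
have ZW t : {ae P, forall w, Z t w = W t w}.
  by apply: filterS (XZ t) => w <-; rewrite /W /= mulrC.
have Pfin : P setT \is a fin_num := fin_num_measure P _ measurableT.
have X1 t : (X t : Om -> R) \in Lfun P 1 := Lfun_subset12 Pfin (X2 t).
have XX1 s t := Lfun2_mul_Lfun1 (X2 s) (X2 t).
have pX2 t : phi \o* (X t : Om -> R) \in Lfun P 2%:E.
  by apply: Lfun_scale => //; rewrite ler1n.
have pX1 t : phi \o* (X t : Om -> R) \in Lfun P 1 := Lfun_subset12 Pfin (pX2 t).
have cE t : covariance P (X 0) (X t) = (autocov X t)%:E.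
  rewrite /autocov fineK//; exact: (covariance_fin_num (X1 0) (X1 t) (XX1 0 t)).
have cS s t : covariance P (X s) (X t) = (autocov X (t - s))%:E.
  by rewrite -cE -(strictly_stationary_covariance s 0 (t - s) sX X2 X0) addr0 subrKC.
rewrite {1}/autocov (ae_eq_covariance _ _ _ _ (ZW 0) (ZW n))// /W.
rewrite covarianceBl//; last by rewrite rpredB ?lee1n//.
rewrite !covarianceBr//.
rewrite (covarianceZl _ (X1 _) (X1 n) (XX1 _ _)).
rewrite (covarianceZl _ (X1 _) (pX1 _) (Lfun2_mul_Lfun1 (X2 _) (pX2 _))).
rewrite !covarianceZr ?XX1// !cS -!EFinM -!EFinB/=.
have -> : n - 0 = n by rewrite subr0.
have -> : n - 1 - 0 = n - 1 by rewrite subr0.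
have -> : n - (0 - 1) = n + 1 by rewrite sub0r opprK.
have -> : n - 1 - (0 - 1) = n by rewrite sub0r opprK subrK.
ring.
Qed.

(** * Continuous images, limit laws and planar vectors *)

Lemma cvg_in_law_comp (d : measure_display) (Om : measurableType d)
    (R : realType) (P : probability Om R) (E E' : topologicalType)
    (d' : measure_display) (Om' : measurableType d') (P' : probability Om' R)
    (Y : nat -> Om -> E) (G : Om' -> E) (h : E -> E') : continuous h ->
  cvg_in_law P Y P' G ->
  cvg_in_law P (fun T w => h (Y T w)) P' (fun w => h (G w)).
Proof.
move=> ch YG f cf [M [Mr fM]].
have cfh : continuous (f \o h).
  by move=> x; apply: continuous_comp; [exact: ch|exact: cf].
apply: (YG _ cfh); exists M; split => // N MN x _.
exact: (fM N MN (h x)).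
Qed.

(** Test expectations see only the law of the limit variable, so the auxiliary space carrying it can
    be traded for the real line with [mu]. *)
Lemma cvg_in_law_distribution (d : measure_display) (Om : measurableType d)
    (R : realType) (P : probability Om R)
    (d' : measure_display) (Om' : measurableType d') (P' : probability Om' R)
    (mu : probability (measurableTypeR R) R)
    (Y : nat -> Om -> R) (U : Om' -> R) : measurable_fun setT U ->
  (forall A : set R, measurable A -> pushforward P' U A = mu A) ->
  cvg_in_law P Y P' U -> cvg_in_law P Y mu idfun.
Proof.
move=> mU Umu YU f cf bf; have := YU f cf bf.
have mf : measurable_fun setT f by exact: continuous_measurable_fun.
have mfU : measurable_fun setT (f \o U) by exact: measurableT_comp.
suff -> : ('E_P'[f \o U] = 'E_mu[f \o idfun])%E by [].
have [M _ fM] := bounded_fun_normr_le bf.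
apply: eq_law_expectation => //.
- exact: measurable_id.
- apply: (bounded_integrable P' mfU).
  by apply: (normr_le_bounded_fun (M := M)) => w; exact: fM.
- exact: (bounded_integrable mu mf bf).
Qed.

Lemma vec2_mul (R : realType) (a b : R) (v : 'cV[R]_2) :
  ((vec2 a b)^T *m v) 0 0 = a * v 0 0 + b * v 1 0.
Proof.
rewrite mxE big_ord_recl big_ord1 !mxE.
by have -> : lift ord0 ord0 = 1 :> 'I_2 by apply/val_inj.
Qed.

Lemma qformN (R : realType) (n : nat) (S : 'M[R]_n) (u : 'cV[R]_n) :
  qform S (- u) = qform S u.
Proof. by rewrite /qform [(- u)^T]linearN !mulNmx mulmxN opprK. Qed.

(** * Asymptotic normality of the truncated estimator *)

Theorem theorem4 (R : realType) (d : measure_display) (Om : measurableType d)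
    (P : probability Om R) (X Z : int -> {RV P >-> R}) (H phi : R) (N : nat)
    (gammahat : forall T : nat, int -> T.-tuple R -> R)
    (l : nat -> R) (Sigma : 'M[R]_2)
    (d' : measure_display) (Om' : measurableType d') (P' : probability Om' R)
    (G : Om' -> 'cV[R]_2) :
  strictly_stationary X ->
  (forall t : int, (X t : Om -> R) \in Lfun P 2%:E) ->
  (forall t : int, ('E_P[X t] = 0)%E) ->
  0 < H -> phi = expR (- H) ->
  strictly_stationary Z ->
  (forall t : int, {ae P, forall w, X t w - phi * X (t - 1) w = Z t w}) ->
  let gamma := autocov X in
  let r := autocov Z in
  (forall T : nat,
    measurable_fun setT (gammahat T (N%:Z + 1)) /\
    measurable_fun setT (gammahat T (N%:Z - 1))) ->
  let ghat := fun (T : nat) (n : int) (w : Om) =>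
    gammahat T n (observations X T w) in
  let phihat := fun (T : nat) (w : Om) =>
    let s := ghat T (N%:Z + 1) w + ghat T (N%:Z - 1) w in
    trunc01 (if s != 0 then - (r N%:Z / s) else 0) in
  gamma N%:Z = 0 -> r N%:Z != 0 ->
  let vgamma := vec2 (gamma (N%:Z + 1)) (gamma (N%:Z - 1)) in
  let vgammahat := fun (T : nat) (w : Om) =>
    vec2 (ghat T (N%:Z + 1) w) (ghat T (N%:Z - 1) w) in
  (forall T : nat, 0 < l T) -> l T @[T --> \oo] --> +oo ->
  covariance_matrix Sigma ->
  normal_vector P' G 0 Sigma ->
  cvg_in_law P (fun T w => l T *: (vgammahat T w - vgamma)) P' G ->
  let gradf : 'cV[R]_2 :=
    - (r N%:Z / (gamma (N%:Z + 1) + gamma (N%:Z - 1)) ^+ 2) *: vec2 1 1 in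
  cvg_in_law P (fun T w => l T * (phihat T w - phi))
    (normal_law 0 (qform Sigma gradf)) idfun.
Proof.
move=> sX X2 X0 H0 phiE sZ XZ gamma r mgh ghat phihat gN0 rN0 vgamma vgammahat.
move=> l0 ly covS nG cG gradf.
set s := gamma (N%:Z + 1) + gamma (N%:Z - 1) in gradf *.
pose F (y : R) := trunc01 (if y != 0 then - (r N%:Z / y) else 0).
(* At lag [N] the term with weight [1 + phi ^+ 2] drops out; this relation yields both [s != 0] and
   the value of [phi]. *)
have rE : r N%:Z = - (phi * s).
  by have := autocov_ar1 N%:Z sX X2 X0 XZ; rewrite -/gamma -/r gN0 mulr0 sub0r.
have s0 : s != 0.
  by apply: contraNneq rN0 => s0; rewrite rE s0 mulr0 oppr0.
have phi01 : 0 < phi < 1.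
  by rewrite phiE expR_gt0 expR_lt1 oppr_lt0.
have phiF : - (r N%:Z / s) = phi by rewrite rE mulNr opprK mulfK.
have Fs : F s = phi.
  rewrite /F s0 phiF trunc01_id//.
  by case/andP: phi01 => p0 p1; rewrite !ltW.
(* The estimator sees the two coordinates only through their sum, so the vector limit is projected
   along [(1, 1)] and the delta method is used in dimension one. *)
pose U w := ((vec2 1 1)^T *m G w) 0 0.
have mU : measurable_fun setT U by have [] := nG (vec2 1 1).
pose shat T w := ghat T (N%:Z + 1) w + ghat T (N%:Z - 1) w.
have mshat T : measurable_fun setT (shat T).
  have mobs : measurable_fun setT (observations X T).
    by apply: measurable_mktuple => i.
  have [mp mm] := mgh T.
  by apply: measurable_funD; exact: measurableT_comp.
have cs : cvg_in_law P (fun T w => l T * (shat T w - s)) P' U.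
  have cu : continuous (fun v : 'cV[R]_2 => ((vec2 1 1)^T *m v) 0 0).
    have -> : (fun v : 'cV[R]_2 => ((vec2 1 1)^T *m v) 0 0) =
        (fun v => v 0 0 + v 1 0).
      by apply/funext => v; rewrite vec2_mul !mul1r.
    have cc i : continuous (fun v : 'cV[R]_2 => v i 0).
      exact: coord_continuous.
    by move=> v; exact: (cvgD (cc 0 v) (cc 1 v)).
  have := cvg_in_law_comp cu cG.
  congr (cvg_in_law P _ P' U); apply/funext => T; apply/funext => w.
  by rewrite vec2_mul !mul1r !mxE /= -mulrDr /shat /s; congr (_ * _); ring.
have dF : is_derive s 1 F (r N%:Z / s ^+ 2).
  by apply: is_derive_plugin => //; rewrite phiF.
have mF : measurable_fun setT F by exact: measurable_plugin.
have := delta_method mshat mU mF dF l0 ly cs.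
rewrite Fs.
(* The limit obtained is [r N / s ^+ 2] times [U], a linear form in [G], so [normal_vector] supplies
   its law, zero variance included. *)
apply: cvg_in_law_distribution; first exact: measurable_funM.
move=> A mA.
(* [gradf] is minus the gradient of [- r N / (a + b)]; the limit law only
   depends on it through a quadratic form. *)
have [_ /(_ A mA)] := nG (- gradf).
rewrite qformN mulmx0 mxE => <-; congr (pushforward P' _ A).
apply/funext => w; rewrite /gradf scaleNr opprK linearZ/= -scalemxAl mxE.
by rewrite /U.
Qed.
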